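(* Let $(X,\tau_X,E)$ be a soft Hausdorff soft topological space equipped with a soft action of a finite group $G$. If for every $e\in E$ the induced action of $G$ on the slice $X_e$ is properly discontinuous in the classical sense, then the soft action of $G$ on $(X,\tau_X,E)$ is properly soft discontinuous.
   Context: Universes and parameter sets are non-empty sets. A soft set over $X$ with parameter set $E$ is a pair $(F,E)$ with $F:E\to\mathcal P(X)$. Soft unions $\bigsqcup$ and intersections $\sqcap$ are taken parameterwise; the null soft set $(0,E)$ is $e\mapsto\emptyset$ and the absolute soft set is $e\mapsto X$. A soft topology $\tau_X$ on $X$ with respect to $E$ is a family of soft sets over $X$ with parameter set $E$ containing the null and absolute soft sets and closed under arbitrary soft unions and finite soft intersections; $(X,\tau_X,E)$ is then a soft topological space and members of $\tau_X$ are called soft open. For $e\in E$, $X_e$ denotes $X$ with the slice topology $\{F(e):(F,E)\in\tau_X\}$. For $x\in X$, $x\,\widetilde\in\,(F,E)$ means $x\in F(e)$ for every $e\in E$. $(X,\tau_X,E)$ is soft Hausdorff if for any distinct $x,y\in X$ there are $(G_1,E),(G_2,E)\in\tau_X$ with $x\,\widetilde\in\,(G_1,E)$, $y\,\widetilde\in\,(G_2,E)$ and $(G_1,E)\sqcap(G_2,E)=(0,E)$. A (left) soft action of a group $G$ with identity $g_0$ on $(X,\tau_X,E)$ is a map $G\times X\to X$, $(g,x)\mapsto g\cdot x$, with $g_0\cdot x=x$, $(gh)\cdot x=g\cdot(h\cdot x)$ for all $g,h\in G$, $x\in X$, and such that for each $g\in G$ the map $\alpha_g:x\mapsto g\cdot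 x$ is soft $\mathrm{id}_E$-continuous, i.e. for every $(F,E)\in\tau_X$ the soft set $e\mapsto\alpha_g^{-1}(F(e))$ is in $\tau_X$. For $g\in G$, $g\cdot(F,E)$ denotes the soft set $e\mapsto g\cdot F(e)$. The soft action is properly soft discontinuous if for every $x\in X$ there is a soft open $(U,E)$ with $x\,\widetilde\in\,(U,E)$ and $g\cdot(U,E)\sqcap(U,E)=(0,E)$ for all $g\ne g_0$. The action on $X_e$ is properly discontinuous in the classical sense if every $x\in X_e$ has an open neighbourhood $U$ in $X_e$ with $g\cdot U\cap U=\emptyset$ for all $g\neq g_0$. *)

(* Defs.v *)
From HB Require Import structures.
From mathcomp Require Import all_boot all_fingroup.
From mathcomp Require Import all_classical topology.

Set Implicit Arguments.
Unset Strict Implicit.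
Unset Printing Implicit Defensive.

Local Open Scope classical_set_scope.

(* The parameter set is the type E itself, so a soft set is its map E -> P(X);
   the operations below are taken parameterwise. *)
Definition softSet (X E : Type) := E -> set X.

Section SoftSets.
Context {X E : Type}.
Implicit Type F : softSet X E.

Definition soft_null : softSet X E := fun=> set0.
Definition soft_abs : softSet X E := fun=> setT.
Definition soft_bigcup (A : set (softSet X E)) : softSet X E :=
  fun e => \bigcup_(F in A) F e.
Definition soft_cap (F1 F2 : softSet X E) : softSet X E := fun e => F1 e `&` F2 e.
Definition soft_image (f : X -> X) F : softSet X E := fun e => f @` F e.
Definition soft_preimage (f : X -> X) F : softSet X E := fun e => f @^-1` F e.
Definition soft_mem (x : X) F := forall e, F e x.

End SoftSets.

(* Binary intersections suffice for closure under finite ones, since the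
   absolute soft set (the empty intersection) is required to be open. *)
Record softTopology (X E : Type) := SoftTopology {
  soft_open : set (softSet X E);
  soft_open_null : soft_open soft_null;
  soft_open_abs : soft_open soft_abs;
  soft_open_bigcup : forall A : set (softSet X E),
    A `<=` soft_open -> soft_open (soft_bigcup A);
  soft_open_cap : forall F1 F2 : softSet X E,
    soft_open F1 -> soft_open F2 -> soft_open (soft_cap F1 F2)
}.

Definition soft_hausdorff (X E : Type) (tau : softTopology X E) :=
  forall x y : X, x <> y ->
    exists G1 G2 : softSet X E,
      [/\ soft_open tau G1, soft_open tau G2, soft_mem x G1, soft_mem y G2
        & soft_cap G1 G2 = soft_null].

(* The space X_e: an alias of X, with tau and e recorded in the type so that the
   slice topology can be attached to it. *)
Definition slice (X E : Type) (tau : softTopology X E) (e : E) : Type := X.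

Section SliceTopology.
Context (X E : Type) (tau : softTopology X E) (e : E).

Definition slice_open : set (set (slice tau e)) :=
  [set F e | F in soft_open tau].

Let slice_openT : slice_open setT.
Proof. by exists soft_abs => //; exact: soft_open_abs. Qed.

Let slice_openI : setI_closed slice_open.
Proof.
move=> _ _ [F1 F1o <-] [F2 F2o <-].
by exists (soft_cap F1 F2) => //; exact: soft_open_cap.
Qed.

Let slice_open_bigU (I : Type) (f : I -> set (slice tau e)) :
  (forall i, slice_open (f i)) -> slice_open (\bigcup_i f i).
Proof.
move=> fo.
exists (soft_bigcup [set F | soft_open tau F /\ exists i, F e = f i]).
  by apply: soft_open_bigcup => F [].
apply/seteqP; split => x.
  by move=> [F [_ [i Fi]] Fx]; exists i => //; rewrite -Fi.
move=> [i _ fx]; have [F Fo Fi] := fo i.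
by exists F; [split=> //; exists i | rewrite Fi].
Qed.

HB.instance Definition _ := gen_eqMixin (slice tau e).
HB.instance Definition _ := gen_choiceMixin (slice tau e).
HB.instance Definition _ := isOpenTopological.Build (slice tau e)
  slice_openT slice_openI slice_open_bigU.

Lemma slice_openE : (open : set (set (slice tau e))) = slice_open.
Proof. by []. Qed.

End SliceTopology.

Record softAction (G : groupType) (X E : Type) (tau : softTopology X E) :=
  SoftAction {
  soft_act :> G -> X -> X;
  soft_act1 : forall x, soft_act 1%g x = x;
  soft_actM : forall g h x, soft_act (g * h)%g x = soft_act g (soft_act h x);
  soft_act_continuous : forall g (F : softSet X E),
    soft_open tau F -> soft_open tau (soft_preimage (soft_act g) F)
}.

Definition properly_soft_discontinuous (G : groupType) (X E : Type)
    (tau : softTopology X E) (a : softAction G tau) :=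
  forall x : X, exists U : softSet X E,
    [/\ soft_open tau U, soft_mem x U
      & forall g : G, g <> 1%g -> soft_cap (soft_image (a g) U) U = soft_null].

Definition slice_action (G : groupType) (X E : Type) (tau : softTopology X E)
    (a : softAction G tau) (e : E) : G -> slice tau e -> slice tau e := a.

Arguments slice_action {G X E tau} a e _ _.

Definition properly_discontinuous (G : groupType) (T : topologicalType)
    (act : G -> T -> T) :=
  forall x : T, exists U : set T,
    open_nbhs x U /\ forall g : G, g <> 1%g -> (act g @` U) `&` U = set0.

(* Main.v *)
(* Proper discontinuity on a single slice already makes the action free, so for
   each g <> 1 the Hausdorff property separates x from g x by soft open sets G1
   and G2. The soft open set G1 /\ g^-1(G2) contains x and is disjoint from its
   translate by g; as G is finite, these sets can be intersected over all g. *)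
Require Import Defs.
From HB Require Import structures.
From mathcomp Require Import all_boot all_fingroup.
From mathcomp Require Import all_classical topology.

Local Open Scope classical_set_scope.

(** A point [x] fixed by [g] would lie in both [U] and its translate by [g]. *)
Lemma properly_discontinuous_free (G : groupType) (T : topologicalType)
    (act : G -> T -> T) (g : G) (x : T) :
  properly_discontinuous act -> g <> 1%g -> act g x <> x.
Proof.
move=> /(_ x)[U [[_ Ux] disjU]] g1 gx.
have : (act g @` U `&` U) x by split=> //; exists x.
by rewrite disjU.
Qed.

Lemma soft_hausdorff_displaced (X E : Type) (tau : softTopology X E)
    (G : groupType) (a : softAction G tau) (g : G) (x : X) :
  soft_hausdorff tau -> a g x <> x ->
  exists V : softSet X E, [/\ soft_open tau V, soft_mem x V
    & soft_cap (soft_image (a g) V) V = soft_null].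
Proof.
move=> hausd /nesym/hausd[G1 [G2 [G1o G2o G1x G2gx G12]]].
exists (soft_cap G1 (soft_preimage (a g) G2)); split.
- exact/soft_open_cap/soft_act_continuous.
- by move=> e; split; [exact: G1x | exact: G2gx].
(* A common point is [a g y] with [y] in the preimage of [G2], so it lies in [G2] as well as in
   [G1]. *)
- apply/funext => e; rewrite -subset0 => _ [[y [_ G2gy] <-] [G1gy _]].
  by have : soft_cap G1 G2 e (a g y); [split | rewrite G12].
Qed.

(** Lets a neighbourhood be shrunk for one group element without losing the disjointness gained for
    the others. *)
Lemma soft_image_cap_null_sub (X E : Type) (f : X -> X) (U V : softSet X E) :
  (forall e, U e `<=` V e) ->
  soft_cap (soft_image f V) V = soft_null ->
  soft_cap (soft_image f U) U = soft_null.
Proof.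
move=> UV V0; apply/funext => e; rewrite -subset0.
rewrite -[set0]/(soft_null e) -V0.
by apply: setISS; [exact/image_subset/UV | exact: UV].
Qed.

(** Induction on a list [s], later the enumeration of [G], builds the finite intersection from
    binary ones. *)
Lemma soft_nbhs_displaced_seq (X E : Type) (tau : softTopology X E)
    (G : groupType) (a : softAction G tau) (x : X) (s : seq G) :
  soft_hausdorff tau -> (forall g : G, g <> 1%g -> a g x <> x) ->
  exists U : softSet X E, [/\ soft_open tau U, soft_mem x U
    & forall g : G, g \in s -> g <> 1%g ->
        soft_cap (soft_image (a g) U) U = soft_null].
Proof.
move=> hausd free; elim: s => [|h s [U [Uo Ux disjU]]].
  by exists soft_abs; split=> //; exact: soft_open_abs.
(* The identity imposes no condition, so [U] is kept. *)
have [h1|h1] := eqVneq h 1%g.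
  exists U; split=> // g; rewrite inE => /predU1P[->|]; last exact: disjU.
  by rewrite h1.
have [V [Vo Vx disjV]] := soft_hausdorff_displaced _ _ _ _ a h x hausd (free _ (elimN eqP h1)).
exists (soft_cap U V); split.
- exact: soft_open_cap.
- by move=> e; split; [exact: Ux | exact: Vx].
- move=> g; rewrite inE => /predU1P[-> _|gs g1].
    by apply: (soft_image_cap_null_sub _ _ _ _ _ _ disjV) => e; exact: subIsetr.
  by apply: (soft_image_cap_null_sub _ _ _ _ _ _ (disjU g gs g1)) => e; exact: subIsetl.
Qed.

Theorem theorem5p0p11 (X E : Type) (X_nonempty : [set: X] !=set0)
  (E_nonempty : [set: E] !=set0) (tau : softTopology X E)
  (tau_hausdorff : soft_hausdorff tau) (G : finGroupType)
  (a : softAction G tau)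
  (a_slice : forall e : E, properly_discontinuous (slice_action a e)) :
  properly_soft_discontinuous a.
Proof.
(* Some slice exists, and [slice_action a e] is [a] itself on points, so its freeness is that of
   [a]. *)
move=> x; have [e _] := E_nonempty.
have free (g : G) : g <> 1%g -> a g x <> x.
  exact: (properly_discontinuous_free _ _ _ _ _ (a_slice e)).
have [U [Uo Ux disjU]] :=
  soft_nbhs_displaced_seq _ _ _ _ a x (enum G) tau_hausdorff free.
by exists U; split=> // g; apply: disjU; rewrite mem_enum.
Qed.
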